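(* Let $G$ be a finite simple graph. Then there is a unique set $X\subseteq V(G)$ such that, writing $X^c=V(G)\setminus X$: (1) $\alpha(G)=\alpha(G[X])+\alpha(G[X^c])$; (2) $G[X]$ is totally independence reducible, i.e. $\alpha'(G[X])=\alpha(G[X])$; (3) $G[X^c]$ is independence irreducible, i.e. $\alpha'(G[X^c])=0$; (4) for every maximum critical independent set $J_c$ of $G$, $X=J_c\cup N(J_c)$.
   Context: All graphs are finite and simple. For a graph $H$ and $S\subseteq V(H)$, $N_H(S)=\bigcup_{u\in S}N_H(u)$ is the set of neighbors of $S$ in $H$ (written $N(S)$ when $H$ is clear); $H[S]$ is the subgraph induced by $S$, and neighborhoods in an induced subgraph are computed within that subgraph. $\alpha(H)$ is the independence number of $H$. An independent set $I_c$ of $H$ is a critical independent set if $|I_c|-|N_H(I_c)|\ge |J|-|N_H(J)|$ for every independent set $J$ of $H$ (the empty set is independent). A maximum critical independent set is a critical independent set of maximum cardinality, and the critical independence number $\alpha'(H)$ is its cardinality. $H$ is totally independence reducible if $\alpha'(H)=\alpha(H)$, and independence irreducible if $\alpha'(H)=0$. *)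

(* Defs.v *)
From mathcomp Require Import all_boot all_order all_algebra.

Set Implicit Arguments.
Unset Strict Implicit.
Unset Printing Implicit Defensive.

Import Order.TTheory GRing.Theory Num.Theory.

Record sgraph := SGraph {
  vertex :> finType;
  adj : rel vertex;
  adj_sym : symmetric adj;
  adj_irr : irreflexive adj
}.

Section Induced.
Variables (G : sgraph) (X : {set G}).

Definition induced_adj : rel {x : G | x \in X} := relpre val (@adj G).

Fact induced_adj_sym : symmetric induced_adj.
Proof. by move=> x y; apply: adj_sym. Qed.

Fact induced_adj_irr : irreflexive induced_adj.
Proof. by move=> x; apply: adj_irr. Qed.

(* The vertex type is the subtype of elements of X, so every notion below,
   in particular N(_), is computed inside the subgraph. *)
Definition induced : sgraph := SGraph induced_adj_sym induced_adj_irr.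

End Induced.

Section Independence.
Variable G : sgraph.
Implicit Types I J S : {set G}.

Definition neighbors S : {set G} := \bigcup_(u in S) [set v | adj u v].

Definition independent S : bool := [forall u in S, forall v in S, ~~ adj u v].

Definition alpha : nat := \max_(S : {set G} | independent S) #|S|.

(* The difference can be negative, hence the integers: subtraction on nat
   would truncate it. *)
Definition crit_diff S : int := (#|S|%:Z - #|neighbors S|%:Z)%R.

Definition critical I : bool :=
  independent I &&
  [forall J : {set G}, independent J ==> (crit_diff J <= crit_diff I)%R].

Definition max_critical I : bool :=
  critical I && [forall J : {set G}, critical J ==> (#|J| <= #|I|)].

Definition alpha' : nat := \max_(I : {set G} | critical I) #|I|.

Definition totally_independence_reducible : Prop := alpha' = alpha.

Definition independence_irreducible : Prop := alpha' = 0.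

End Independence.

(* Main.v *)
(** Every vertex set [S] satisfies [d(S \ N(S)) >= d(S)], where
    [d(S) = |S| - |N(S)|], and [S \ N(S)] is independent; so a critical
    independent set maximizes the supermodular function [d] over all vertex
    sets, and maximizers are closed under union.  Moreover, if [J] is critical,
    every [T \subset N(J)] has at least [|T|] neighbors in [J] (otherwise
    [J \ N(T)] beats [J]).  This Hall condition shows that [J] is a maximum and
    critical independent set of the graph induced by [J :|: N(J)], and, together
    with closure under union, that [J :|: N(J)] is the same for all maximum
    critical [J].  A nonempty critical set of the complementary graph could be
    added to [J], contradicting its maximality. *)
Require Import Defs.
From mathcomp Require Import all_boot all_order all_algebra.
From mathcomp Require Import zify.

Set Implicit Arguments.
Unset Strict Implicit.
Unset Printing Implicit Defensive.

(** * Neighborhoods and independence *)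

Section Graph.
Variable G : sgraph.
Implicit Types A B I J K S T X : {set G}.

Lemma neighborsP S v :
  reflect (exists2 u, u \in S & adj u v) (v \in neighbors S).
Proof.
by apply: (iffP bigcupP) => -[u uS uv]; exists u; rewrite ?inE // in uv *.
Qed.

Lemma mem_neighbors S u v : u \in S -> adj u v -> v \in neighbors S.
Proof. by move=> uS uv; apply/neighborsP; exists u. Qed.

Lemma neighborsU A B : neighbors (A :|: B) = neighbors A :|: neighbors B.
Proof. exact: bigcup_setU. Qed.

Lemma neighborsS A B : A \subset B -> neighbors A \subset neighbors B.
Proof. by move=> /setUidPr <-; rewrite neighborsU subsetUl. Qed.

Lemma neighbors0 : neighbors set0 = set0 :> {set G}.
Proof. exact: big_set0. Qed.

Lemma independentP S :
  reflect {in S &, forall u v, ~~ adj u v} (independent S).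
Proof.
apply: (iffP forall_inP) => [h u v uS vS | h u uS]; last first.
  by apply/forall_inP => v; apply: h.
by move/forall_inP: (h u uS); apply.
Qed.

Lemma independentE S : independent S = [disjoint S & neighbors S].
Proof.
apply/independentP/pred0P => [h v | h u v uS vS].
  apply/negP => /= /andP[vS /neighborsP[u uS]].
  by apply/negP; apply: h.
apply/negP => uv; have /= := h v.
by rewrite vS (mem_neighbors uS uv).
Qed.

Lemma independent0 : independent (set0 : {set G}).
Proof. by apply/independentP => u v; rewrite inE. Qed.

Lemma independentS A B : A \subset B -> independent B -> independent A.
Proof.
move=> /subsetP sAB /independentP h.
by apply/independentP => u v /sAB uB /sAB; apply: h.
Qed.

Lemma disjoint_neighborsC A B :
  [disjoint A & neighbors B] = [disjoint B & neighbors A].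
Proof.
suff h (C D : {set G}) : [disjoint C & neighbors D] -> [disjoint D & neighbors C].
  by apply/idP/idP; apply: h.
move=> /pred0P h; apply/pred0P => v /=; apply/negP => /andP[vD].
move=> /neighborsP[u uC uv]; have /= := h u; rewrite uC.
by rewrite (mem_neighbors vD) // adj_sym.
Qed.

Lemma independentU A B :
  independent A -> independent B -> [disjoint A & neighbors B] ->
  independent (A :|: B).
Proof.
rewrite !independentE neighborsU => iA iB dAB.
rewrite -!setI_eq0 in iA iB *; have dBA := dAB.
rewrite disjoint_neighborsC in dBA; rewrite -!setI_eq0 in dAB dBA.
rewrite setIUl !setIUr.
by rewrite (eqP iA) (eqP iB) (eqP dAB) (eqP dBA) !setU0.
Qed.

(** * Supermodularity of [crit_diff] and critical sets *)

Lemma crit_diffU A B :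
  (crit_diff A + crit_diff B <= crit_diff (A :|: B) + crit_diff (A :&: B))%R.
Proof.
rewrite /crit_diff neighborsU.
have := cardsUI A B; have := cardsUI (neighbors A) (neighbors B).
have : neighbors (A :&: B) \subset neighbors A :&: neighbors B.
  by rewrite subsetI !neighborsS ?subsetIl ?subsetIr.
by move=> /subset_leq_card; lia.
Qed.

Lemma independent_setD_neighbors S : independent (S :\: neighbors S).
Proof.
apply/independentP => u v; rewrite !inE => /andP[_ uS] /andP[vN _].
by apply: contraNN vN; apply: mem_neighbors.
Qed.

(** No vertex of [S] is adjacent to a vertex of [S :\: neighbors S], so passing to this set removes
    [S :&: neighbors S] from the neighborhood as well as from [S]. *)
Lemma crit_diff_setD_neighbors S :
  (crit_diff S <= crit_diff (S :\: neighbors S))%R.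
Proof.
have sN : neighbors (S :\: neighbors S) \subset neighbors S :\: S.
  apply/subsetP => v /neighborsP[u]; rewrite !inE => /andP[uN uS] uv.
  rewrite (mem_neighbors uS uv) andbT; apply: contraNN uN => vS.
  by rewrite (mem_neighbors vS) // adj_sym.
have := subset_leq_card sN; rewrite /crit_diff.
have := cardsID S (neighbors S); have := cardsID (neighbors S) S.
by rewrite setIC; lia.
Qed.

(** Competitors may be arbitrary sets here, which lets supermodularity be applied to unions that are
    not independent. *)
Lemma criticalP I :
  reflect (independent I /\ forall S, (crit_diff S <= crit_diff I)%R)
          (critical I).
Proof.
apply: (iffP andP) => -[iI h]; split=> //; last by apply/forall_inP => S _.
move=> S; apply: Order.POrderTheory.le_trans (crit_diff_setD_neighbors S) _.
by move/forall_inP: h; apply; apply: independent_setD_neighbors.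
Qed.

Lemma critical_of_ge I K :
  critical I -> independent K -> (crit_diff I <= crit_diff K)%R -> critical K.
Proof.
move=> /criticalP[_ hI] iK IK; apply/criticalP; split=> // S.
exact: Order.POrderTheory.le_trans (hI S) IK.
Qed.

Lemma max_criticalP J :
  reflect (critical J /\ forall K, critical K -> #|K| <= #|J|)
          (max_critical J).
Proof.
by apply: (iffP andP) => -[cJ h]; split=> //; apply/forall_inP.
Qed.

Lemma max_critical_subset J K : max_critical J -> critical K -> J \subset K -> K = J.
Proof.
move=> /max_criticalP[_ mJ] cK sJK; apply/esym/eqP.
by rewrite eqEcard sJK mJ.
Qed.

Lemma max_critical_exists : exists J, max_critical J.
Proof.
(* [w] is [crit_diff] shifted by [#|G|] to take values in [nat]; the truncated subtraction is exact,
   since a neighborhood has at most [#|G|] vertices. *)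
pose w S := #|S| + (#|G| - #|neighbors S|).
have [I iI maxI] := arg_maxnP w independent0.
have cI : critical I.
  rewrite /critical iI; apply/forall_inP => S /maxI; rewrite /w /crit_diff.
  by have := max_card (neighbors I); have := max_card (neighbors S); lia.
have [J cJ maxJ] := arg_maxnP (fun S => #|S|) cI.
by exists J; apply/max_criticalP.
Qed.

(** Deleting [neighbors T] from [J] costs [#|J :&: neighbors T|] vertices and frees all of [T] from
    the neighborhood; criticality forbids a net gain. *)
Lemma critical_hall J T :
  critical J -> T \subset neighbors J -> #|T| <= #|J :&: neighbors T|.
Proof.
move=> /criticalP[_ /(_ (J :\: neighbors T)) h] sT.
have sN : neighbors (J :\: neighbors T) \subset neighbors J :\: T.
  apply/subsetP => v /neighborsP[u]; rewrite !inE => /andP[uN uJ] uv.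
  rewrite (mem_neighbors uJ uv) andbT; apply: contraNN uN => vT.
  by rewrite (mem_neighbors vT) // adj_sym.
have := subset_leq_card sN; move: h; rewrite /crit_diff.
have := cardsID T (neighbors J); have := cardsID (neighbors T) J.
by rewrite (setIidPr sT); lia.
Qed.

(** By supermodularity [I :|: J] maximizes [crit_diff], hence so does its independent part [S'], and
    then [S' :|: J]. This last set is [J :|: (I :\: neighbors J)], which is independent, so
    maximality of [J] puts [I :\: neighbors J] inside [J]. *)
Lemma max_critical_sub_closure I J :
  max_critical I -> max_critical J -> I \subset J :|: neighbors J.
Proof.
move=> /max_criticalP[cI _] mJ; have [cJ _] := max_criticalP _ mJ.
have [iI hI] := criticalP _ cI; have [iJ hJ] := criticalP _ cJ.
pose S := I :|: J; pose S' := S :\: neighbors S.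
have dS' : (crit_diff J <= crit_diff S')%R.
  have := crit_diff_setD_neighbors S; have := crit_diffU I J.
  by have := hI (I :&: J); have := hJ I; rewrite -/S -/S'; lia.
pose K := J :|: (I :\: neighbors J).
(* Since [I] is independent, a vertex of [I] outside [neighbors J] survives in [S']. *)
have KE : K = S' :|: J.
  apply/setP => v; rewrite /K /S' /S neighborsU !inE.
  case: (boolP (v \in J)) => [|vJ]; first by rewrite !orbT.
  rewrite !orbF /=; case: (boolP (v \in I)) => vI; last by rewrite !andbF.
  by move: iI; rewrite independentE => /disjointFr -> //; rewrite orbF.
have cK : critical K.
  apply: (critical_of_ge cJ).
    apply: independentU => //; first by apply: independentS iI; apply: subsetDl.
    rewrite disjoint_neighborsC -setI_eq0 -subset0; apply/subsetP => v.
    by rewrite !inE => /andP[/andP[/negPf->]].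
  by have := crit_diffU S' J; have := hJ (S' :&: J); rewrite KE; lia.
have KJ := max_critical_subset mJ cK (subsetUl _ _).
apply/subsetP => v vI; rewrite inE -[in X in X || _]KJ !inE vI andbT.
by case: (v \in neighbors J); rewrite ?orbT.
Qed.

(** The Hall condition is used twice: for [I] it gives [#|U| + #|T| <= #|I :&: neighbors J|], for
    [J] it bounds the right side by [#|T|]. So [U] is empty. *)
Lemma max_critical_closure_sub I J :
  max_critical I -> max_critical J ->
  I :|: neighbors I \subset J :|: neighbors J.
Proof.
move=> mI mJ; have sI := max_critical_sub_closure mI mJ.
have [cI _] := max_criticalP _ mI; have [cJ _] := max_criticalP _ mJ.
rewrite subUset sI /=; pose U := neighbors I :\: (J :|: neighbors J).
pose T := J :&: neighbors I.
have leIJ : #|I :&: neighbors J| <= #|T|.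
  apply: leq_trans (critical_hall cJ (subsetIr I _)) _.
  by rewrite subset_leq_card // setIS // neighborsS // subsetIl.
have sUT : U :|: T \subset neighbors I by rewrite subUset subsetDl subsetIr.
(* A neighbor in [I] of a vertex of [U] lies in [J] or [neighbors J]; the former would put that
   vertex of [U] in [neighbors J]. *)
have sN : I :&: neighbors (U :|: T) \subset I :&: neighbors J.
  rewrite neighborsU setIUr subUset; apply/andP; split; last first.
    by rewrite setIS // neighborsS // subsetIl.
  apply/subsetP => v; rewrite !inE => /andP[vI /neighborsP[u]].
  rewrite !inE negb_or => /andP[/andP[_ uNJ] _] uv; rewrite vI /=.
  have := subsetP sI v vI; rewrite inE => /orP[vJ|//].
  by case/negP: uNJ; rewrite (mem_neighbors vJ) // adj_sym.
have := leq_trans (critical_hall cI sUT) (subset_leq_card sN).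
have dUT : U :&: T = set0.
  apply/eqP; rewrite -subset0; apply/subsetP => v.
  by rewrite !inE; case: (v \in J); rewrite ?andbF.
rewrite cardsU dUT cards0 subn0 => le; have /eqP : #|U| = 0 by lia.
by rewrite cards_eq0 setD_eq0.
Qed.

Lemma leq_alpha S : independent S -> #|S| <= alpha G.
Proof. by move=> iS; apply: (leq_bigmax_cond (F := fun A : {set G} => #|A|)). Qed.

Lemma alpha_witness : exists2 S : {set G}, independent S & alpha G = #|S|.
Proof.
have : 0 < #|[pred S : {set G} | independent S]|.
  by apply/card_gt0P; exists set0; apply: independent0.
by move=> /(eq_bigmax_cond (fun A : {set G} => #|A|))[S iS eS]; exists S.
Qed.

Lemma leq_alpha' I : critical I -> #|I| <= alpha' G.
Proof. by move=> cI; apply: (leq_bigmax_cond (F := fun A : {set G} => #|A|)). Qed.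

Lemma alpha'_leq_alpha : alpha' G <= alpha G.
Proof. by apply/bigmax_leqP => I /criticalP[iI _]; apply: leq_alpha. Qed.

End Graph.

(** * Transfer between an induced subgraph and the whole graph *)

Section InducedSets.
Variables (G : sgraph) (X : {set G}).
Implicit Types S : {set induced X}.

Definition lift_set S : {set G} := [set val x | x in S].

Lemma lift_set_sub S : lift_set S \subset X.
Proof. by apply/subsetP => _ /imsetP[x _ ->]; apply: valP. Qed.

Lemma card_lift_set S : #|lift_set S| = #|S|.
Proof. by rewrite card_imset //; apply: val_inj. Qed.

Lemma mem_lift_set S (x : induced X) : (val x \in lift_set S) = (x \in S).
Proof. by apply: mem_imset; apply: val_inj. Qed.

Lemma lift_set_surj (A : {set G}) :
  A \subset X -> exists S : {set induced X}, lift_set S = A.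
Proof.
move=> sAX; exists [set x | val x \in A]; apply/setP => v.
apply/imsetP/idP => [[x] | vA]; first by rewrite inE => xA ->.
by exists (Sub v (subsetP sAX v vA)); rewrite ?inE.
Qed.

Lemma independent_lift_set S : independent (lift_set S) = independent S.
Proof.
apply/independentP/independentP => h u v; last first.
  by move=> /imsetP[x xS ->] /imsetP[y yS ->]; apply: h.
by move=> uS vS; apply: (h (val u) (val v)); rewrite mem_lift_set.
Qed.

Lemma lift_set_neighbors S :
  lift_set (neighbors S) = neighbors (lift_set S) :&: X.
Proof.
apply/setP => v; rewrite inE; apply/imsetP/andP => [[x xN ->] | [vN vX]].
  split; last exact: valP.
  have /neighborsP[y yS yx] := xN; apply/neighborsP; exists (val y) => //.
  by rewrite mem_lift_set.
exists (Sub v vX : induced X) => //.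
have /neighborsP[_ /imsetP[y yS ->] yv] := vN.
by apply/neighborsP; exists y.
Qed.

Lemma crit_diff_induced S :
  crit_diff S =
  (#|lift_set S|%:Z - #|neighbors (lift_set S) :&: X|%:Z)%R.
Proof. by rewrite /crit_diff -lift_set_neighbors !card_lift_set. Qed.

End InducedSets.

Lemma alpha_leqD (G : sgraph) (X : {set G}) :
  alpha G <= alpha (induced X) + alpha (induced (~: X)).
Proof.
have [S iS ->] := alpha_witness G.
have part (Y : {set G}) : #|S :&: Y| <= alpha (induced Y).
  have [A AE] := lift_set_surj (subsetIr S Y).
  rewrite -AE card_lift_set leq_alpha // -independent_lift_set AE.
  by apply: independentS iS; apply: subsetIl.
by rewrite -(cardsID X S) setDE leq_add.
Qed.

(** * The decomposition given by a critical set and its neighbors *)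

Section Closure.
Variables (G : sgraph) (J : {set G}).
Hypothesis cJ : critical J.
Let X := J :|: neighbors J.

Lemma card_closure_parts (K : {set G}) :
  K \subset X -> independent K ->
  #|K| = #|K :&: J| + #|K :&: neighbors J|.
Proof.
move=> sKX iK; have [iJ _] := criticalP _ cJ.
rewrite -[in LHS](setIidPl sKX) setIUr cardsU -setIIr.
by move: iJ; rewrite independentE -setI_eq0 => /eqP->; rewrite setI0 cards0 subn0.
Qed.

(** An independent [K] in [X] can trade [K :&: neighbors J] for its neighbors in [J]: these lie
    outside [K] and, by the Hall condition, are at least as many. *)
Lemma alpha_closure : alpha (induced X) = #|J|.
Proof.
have [iJ _] := criticalP _ cJ; apply/eqP; rewrite eqn_leq; apply/andP; split.
  have [S iS ->] := alpha_witness (induced X).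
  rewrite -independent_lift_set in iS; rewrite -card_lift_set.
  have := lift_set_sub S; move: (lift_set S) iS => K iK sKX.
  rewrite (card_closure_parts sKX iK).
  have := critical_hall cJ (subsetIr K (neighbors J)).
  have : J :&: neighbors (K :&: neighbors J) \subset J :\: K.
    apply/subsetP => v; rewrite !inE => /andP[vJ vN]; rewrite vJ andbT.
    apply: contraTN vN => vK; move: iK; rewrite independentE => /disjointFr h.
    apply: contraFN (h v vK); apply: subsetP.
    exact: neighborsS (subsetIl _ _).
  by move=> /subset_leq_card; have := cardsID K J; rewrite (setIC J K); lia.
have [S SE] := lift_set_surj (subsetUl J (neighbors J)).
by rewrite -SE card_lift_set leq_alpha // -independent_lift_set SE.
Qed.

(** Split a competitor [K] into [A] in [J] and [T] in [neighbors J]. [A] does no better than [J],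
    and the Hall condition pays for [T] with [J :&: neighbors T]. *)
Lemma critical_closure (S : {set induced X}) : lift_set S = J -> critical S.
Proof.
move=> SE; have [iJ maxJ] := criticalP _ cJ.
rewrite /critical -independent_lift_set SE iJ /=.
apply/forall_inP => S1 iS1; rewrite !crit_diff_induced SE.
rewrite -independent_lift_set in iS1.
have := lift_set_sub S1; move: (lift_set S1) iS1 => K iK sKX.
rewrite (card_closure_parts sKX iK).
have -> : neighbors J :&: X = neighbors J by apply/setIidPl/subsetUr.
have := critical_hall cJ (subsetIr K (neighbors J)).
have := maxJ (K :&: J); rewrite /crit_diff.
set A := K :&: J; set T := K :&: neighbors J.
(* [A] lies in the independent set [J], so the two costs are not counted twice. *)
have dAT : neighbors A :&: (J :&: neighbors T) = set0.
  apply/eqP; rewrite setIA -subset0.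
  apply: subset_trans (subsetIl _ _) _; rewrite subset0 setI_eq0 disjoint_sym.
  move: iJ; rewrite independentE => /disjointWr; apply.
  by apply: neighborsS; apply: subsetIr.
have : neighbors A :|: (J :&: neighbors T) \subset neighbors K :&: X.
  rewrite subUset !subsetI !neighborsS ?subsetIl //=.
  rewrite (subset_trans (neighborsS (subsetIr K J)) (subsetUr _ _)) /=.
  rewrite (subset_trans (subsetIr _ _) (neighborsS (subsetIl _ _))) /=.
  exact: subset_trans (subsetIl _ _) (subsetUl _ _).
by move=> /subset_leq_card; rewrite cardsU dAT cards0 subn0; lia.
Qed.

Lemma closure_reducible : totally_independence_reducible (induced X).
Proof.
apply/eqP; rewrite eqn_leq alpha'_leq_alpha alpha_closure /=.
have [S SE] := lift_set_surj (subsetUl J (neighbors J)).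
by rewrite -{1}SE card_lift_set leq_alpha' // critical_closure.
Qed.

Lemma independentU_closureC (K : {set G}) :
  K \subset ~: X -> independent K -> independent (J :|: K).
Proof.
move=> sKX iK; have [iJ _] := criticalP _ cJ.
apply: independentU => //; rewrite disjoint_neighborsC.
by rewrite disjoints_subset (subset_trans sKX) // setCS subsetUr.
Qed.

Lemma cardsU_closureC (K : {set G}) :
  K \subset ~: X -> #|J :|: K| = #|J| + #|K|.
Proof.
move=> sKX; rewrite cardsU setIC.
suff -> : K :&: J = set0 by rewrite cards0 subn0.
apply/eqP; rewrite setI_eq0 disjoints_subset.
by rewrite (subset_trans sKX) // setCS subsetUl.
Qed.

(** No edge joins [J] to the complement of [X], so [J] together with a maximum independent set there
    is independent. *)
Lemma alpha_closureD : alpha G = alpha (induced X) + alpha (induced (~: X)).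
Proof.
apply/eqP; rewrite eqn_leq alpha_leqD alpha_closure /=.
have [S iS ->] := alpha_witness (induced (~: X)).
rewrite -card_lift_set -cardsU_closureC ?lift_set_sub // leq_alpha //.
by rewrite independentU_closureC ?lift_set_sub ?independent_lift_set.
Qed.

(** A critical [K] of the complement does at least as well as [set0], and its neighbors in [X]
    already lie in [neighbors J]. Hence [J :|: K] is critical, and maximality of [J] makes [K]
    empty. *)
Lemma closureC_irreducible :
  max_critical J -> independence_irreducible (induced (~: X)).
Proof.
move=> /max_criticalP[_ maxJ]; apply/eqP; rewrite -leqn0.
apply/bigmax_leqP => S /criticalP[iS /(_ set0)].
rewrite {1}/crit_diff neighbors0 !cards0 crit_diff_induced -card_lift_set.
rewrite -independent_lift_set in iS.
have := lift_set_sub S; move: (lift_set S) iS => K iK sKX dK.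
have iJK := independentU_closureC sKX iK.
have sN : neighbors (J :|: K) \subset neighbors J :|: (neighbors K :&: ~: X).
  rewrite neighborsU subUset subsetUl /=; apply/subsetP => v vN.
  rewrite !inE vN; case: (boolP (v \in neighbors J)) => //= _; rewrite orbF.
  apply/negP => vJ; move: iJK; rewrite independentE neighborsU => /disjointFr.
  by move=> /(_ v); rewrite !inE vJ vN orbT => /(_ isT).
have := subset_leq_card sN; rewrite cardsU => leN.
have : critical (J :|: K).
  by apply: (critical_of_ge cJ) => //; rewrite /crit_diff cardsU_closureC //; lia.
by move=> /maxJ; rewrite cardsU_closureC //; lia.
Qed.

End Closure.

Theorem theorem2p4 (G : sgraph) :
  exists! X : {set G},
    [/\ alpha G = alpha (induced X) + alpha (induced (~: X)),
        totally_independence_reducible (induced X),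
        independence_irreducible (induced (~: X))
      & forall J : {set G}, max_critical J -> X = J :|: neighbors J].
Proof.
have [J mJ] := max_critical_exists G; have [cJ _] := max_criticalP _ mJ.
(* Uniqueness: the fourth condition at this [J] determines the set. *)
exists (J :|: neighbors J); split; last by move=> Y [_ _ _ /(_ J mJ)].
split=> [|||I mI].
- exact: alpha_closureD.
- exact: closure_reducible.
- exact: closureC_irreducible.
- by apply/eqP; rewrite eqEsubset !max_critical_closure_sub.
Qed.
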